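(* Let $\mathcal T=\{T_1,\dots,T_m\}\subset\mathbb C^{d\times d}$ be a family of matrices that are all upper triangular or all lower triangular, with nonzero diagonal entries $(T_i)_{jj}=\lambda_j^{(i)}$, and with probability weights $p_1,\dots,p_m$. Let $\rho_\infty^{(j)}:=\prod_{i=1}^m|\lambda_j^{(i)}|^{p_i}$, $\rho_\infty:=\max_{1\le j\le d}\rho_\infty^{(j)}$, $J:=\arg\max_{1\le j\le d}\rho_\infty^{(j)}$. Assume $J=\{j^\star\}$ and let $$\sigma_\infty^{(j)}:=\rho_\infty^{(j)}\left(\sum_{i=1}^m p_i(\log|\lambda_j^{(i)}|)^2-\Bigl(\sum_{i=1}^m p_i\log|\lambda_j^{(i)}|\Bigr)^2\right)^{1/2}.$$ If $\sigma_\infty^{(j^\star)}>0$, then for every $x\in\mathbb R$ $$\lim_{n\to\infty}\mathbb P\left(\frac{\rho_n(\mathcal T,\mathbb P_{\mathcal T})-\rho_\infty}{n^{-1/2}\sigma_\infty^{(j^\star)}}<x\right)=\Phi(x).$$ If $\sigma_\infty^{(j^\star)}=0$, then the limiting fluctuation is degenerate, i.e. $\sqrt n(\rho_n(\mathcal T,\mathbb P_{\mathcal T})-\rho_\infty)$ converges in distribution to $0$.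
   Context: $\mathbb P_{\mathcal T}$ assigns mass $p_i\ge 0$ to $T_i$, with $\sum_i p_i=1$. Let $(i_k)_{k\ge1}$ be i.i.d. random indices in $\{1,\dots,m\}$ with $\mathbb P(i_k=i)=p_i$. The random spectral radius of length $n$ is $\rho_n(\mathcal T,\mathbb P_{\mathcal T}):=\rho(T_{i_n}\cdots T_{i_1})^{1/n}$, where $\rho(\cdot)$ is the spectral radius. $\Phi$ is the standard normal cumulative distribution function. *)

(* Defs.v *)
From HB Require Import structures.
From mathcomp Require Import all_boot all_order all_algebra.
From mathcomp Require Import finmap.
From mathcomp Require Import all_classical all_reals all_analysis.
From mathcomp Require Import measurable_realfun complex.

Set Implicit Arguments.
Unset Strict Implicit.
Unset Printing Implicit Defensive.

Import Order.TTheory GRing.Theory Num.Theory.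
Import numFieldNormedType.Exports.

Local Open Scope classical_set_scope.
Local Open Scope ring_scope.

(* Measurable types are pointed, hence 'I_m.+1 rather than 'I_m. *)
HB.instance Definition _ (m : nat) := isPointed.Build 'I_m.+1 ord0.

HB.instance Definition _ (m : nat) := @isMeasurable.Build
  default_measure_display 'I_m.+1 (@discrete_measurable 'I_m.+1)
  (@discrete_measurable0 'I_m.+1) (@discrete_measurableC 'I_m.+1)
  (@discrete_measurableU 'I_m.+1).

Section probability.
Context d (Omega : measurableType d) (R : realType) (P : probability Omega R).

Definition mutually_independent (I : choiceType) d' (E : measurableType d')
    (X : I -> {RV P >-> E}) : Prop :=
  forall (s : {fset I}) (B : I -> set E),
    (forall k, k \in s -> measurable (B k)) ->
    P (\bigcap_(k in [set` s]) (X k @^-1` B k)) =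
    (\prod_(k <- s) P (X k @^-1` B k))%E.

Definition iid_with_weights (m : nat) (p : 'I_m.+1 -> R)
    (idx : nat -> {RV P >-> 'I_m.+1}) : Prop :=
  mutually_independent idx /\
  forall k i, P (idx k @^-1` [set i]) = (p i)%:E.

(* Weak convergence: pointwise convergence of the distribution functions at
   the continuity points of the limiting one. *)
Definition cvg_in_distribution (X_ : nat -> {RV P >-> R}) d'
    (Omega' : measurableType d') (Q : probability Omega' R)
    (X : {RV Q >-> R}) : Prop :=
  forall x : R, {for x, continuous (cdf X)} ->
    cdf (X_ n) x @[n --> \oo] --> cdf X x.

End probability.

Definition std_normal_cdf (R : realType) (x : R) : \bar R :=
  normal_prob 0 1 `]-oo, x].

Section spectral.
Context (R : realType) (d : nat).

Definition spectral_radius (A : 'M[R[i]]_d) : R :=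
  sup [set Normc.normc a | a in [set a | eigenvalue A a]].

Context (m : nat) (T : 'I_m -> 'M[R[i]]_d).

(* With indices counted from 0, [word_prod u n] is
   T_(u (n-1)) *m ... *m T_(u 0): later factors are on the left. *)
Fixpoint word_prod (u : nat -> 'I_m) (n : nat) : 'M[R[i]]_d :=
  if n is k.+1 then T (u k) *m word_prod u k else 1%:M.

Lemma eq_word_prod (u v : nat -> 'I_m) (n : nat) :
  (forall k, (k < n)%N -> u k = v k) -> word_prod u n = word_prod v n.
Proof.
elim: n => [//|n IHn] uv /=; rewrite uv ?ltnSn// IHn// => k kn.
by rewrite uv// ltnS ltnW.
Qed.

Context (p : 'I_m -> R).

Definition log_diag (j : 'I_d) (i : 'I_m) : R := ln (Normc.normc (T i j j)).

Definition rho_inf_at (j : 'I_d) : R :=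
  \prod_(i < m) (Normc.normc (T i j j) `^ p i).

(* The [rho_inf_at j] are nonnegative, so the default 0 is harmless. *)
Definition rho_inf : R := \big[Num.max/0]_(j < d) rho_inf_at j.

Definition argmax_rho_inf : set 'I_d := [set j | rho_inf_at j = rho_inf].

Definition sigma_inf_at (j : 'I_d) : R :=
  rho_inf_at j *
  Num.sqrt (\sum_(i < m) p i * log_diag j i ^+ 2 -
            (\sum_(i < m) p i * log_diag j i) ^+ 2).

End spectral.

Section random_spectral_radius.
Context d (Omega : measurableType d) (R : realType) (P : probability Omega R).
Context (dim m : nat) (T : 'I_m.+1 -> 'M[R[i]]_dim).
Context (idx : nat -> {RV P >-> 'I_m.+1}) (n : nat).

Definition random_rho (w : Omega) : R :=
  spectral_radius (word_prod T (fun k => idx k w) n) `^ n%:R^-1.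

Lemma measurable_random_rho : measurable_fun setT random_rho.
Proof.
move=> _ Y _; rewrite setTI.
pose word w : {ffun 'I_n -> 'I_m.+1} := [ffun k : 'I_n => idx k w].
have word_rho w w' : word w = word w' -> random_rho w = random_rho w'.
  move=> /ffunP eqw; rewrite /random_rho (@eq_word_prod _ _ _ _ _ (idx^~ w')) //.
  by move=> k kn; have := eqw (Ordinal kn); rewrite !ffunE.
have mword f : measurable (word @^-1` [set f]).
  have -> : word @^-1` [set f] =
      \bigcap_(k in [set: 'I_n]) (idx k @^-1` [set f k]).
    apply/seteqP; split=> [w <- k _ /=|w wf]; first by rewrite ffunE.
    by apply/ffunP => k; rewrite ffunE; exact: wf.
  apply: fin_bigcap_measurable => // k _.
  by rewrite -[X in measurable X]setTI; exact: measurable_funP.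
have -> : random_rho @^-1` Y =
    \bigcup_(f in word @` (random_rho @^-1` Y)) (word @^-1` [set f]).
  apply/seteqP; split=> [w Yw|w [f [w' Yw' <-] /= /word_rho eqw]].
    by exists (word w) => //; exists w.
  by rewrite /preimage /= eqw.
by apply: fin_bigcup_measurable => // f _; exact: mword.
Qed.

HB.instance Definition _ :=
  isMeasurableFun.Build _ _ _ _ random_rho measurable_random_rho.

End random_spectral_radius.

(* Main.v *)
(** Since the matrices are triangular, the spectral radius of the product over
    a word is the largest of the [exp S_j], where [S_j] is the sum over the
    letters of the logarithms of the moduli of the [j]-th diagonal entries.
    By Chebyshev's inequality [S_jstar] dominates every other [S_j] with
    probability tending to 1, so that [rho_n] may be replaced by
    [exp (S_jstar / n)]; monotonicity of [exp] then turns the event of the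
    theorem into [W_n < y_n] with [W_n] the normalised sum and [y_n --> x].

    The central limit theorem for [W_n] is proved by Stein's method, restricted
    to compactly supported Lipschitz test functions [g] of Gaussian mean 0: then
    the solution [f] of [f' - t f = g] is itself compactly supported, and
    [E (f' (W_n) - W_n f (W_n)) = O(1 / sqrt n)] by Taylor expansion.  General
    test functions are truncated, the error being controlled by
    [E W_n^2 = 1].  As the letters take finitely many values, all expectations
    are iterated finite sums. *)

Require Import Defs.
From HB Require Import structures.
From mathcomp Require Import all_boot all_order all_algebra.
From mathcomp Require Import finmap.
From mathcomp Require Import all_classical all_reals all_analysis.
From mathcomp Require Import measurable_realfun complex.
From mathcomp Require Import ring lra.

Set Implicit Arguments.
Unset Strict Implicit.
Unset Printing Implicit Defensive.

Import Order.TTheory GRing.Theory Num.Theory.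
Import numFieldNormedType.Exports.

Local Open Scope classical_set_scope.
Local Open Scope ring_scope.

(** * Means over words of independent letters *)

Section word_mean.
Context (R : rcfType) (I : finType) (p : I -> R).

(** Expectation of [F] over [n] independent letters of law [p]. The first letter is summed
    outermost, so that induction on [n] conditions on it. *)
Fixpoint word_mean (n : nat) (F : seq I -> R) : R :=
  if n is k.+1 then \sum_i p i * word_mean k (fun s => F (i :: s))
  else F [::].

Lemma word_meanS n F :
  word_mean n.+1 F = \sum_i p i * word_mean n (fun s => F (i :: s)).
Proof. by []. Qed.

Lemma word_mean0 F : word_mean 0 F = F [::].
Proof. by []. Qed.

Arguments word_mean : simpl never.

Lemma eq_word_mean n F G : F =1 G -> word_mean n F = word_mean n G.
Proof.
elim: n F G => [|n IHn] F G FG; rewrite ?word_meanS; first exact: FG.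
by apply: eq_bigr => i _; congr (_ * _); apply: IHn => s.
Qed.

Lemma word_meanD n F G :
  word_mean n (fun s => F s + G s) = word_mean n F + word_mean n G.
Proof.
elim: n F G => // n IHn F G; rewrite !word_meanS.
by rewrite -big_split; apply: eq_bigr => i _; rewrite IHn mulrDr.
Qed.

Lemma word_meanZ n a F : word_mean n (fun s => a * F s) = a * word_mean n F.
Proof.
elim: n F => // n IHn F; rewrite !word_meanS.
by rewrite mulr_sumr; apply: eq_bigr => i _; rewrite IHn mulrCA.
Qed.

Lemma word_meanB n F G :
  word_mean n (fun s => F s - G s) = word_mean n F - word_mean n G.
Proof.
rewrite -[X in _ = _ + X]mulN1r -word_meanZ -word_meanD.
by apply: eq_word_mean => s; rewrite mulN1r.
Qed.

Lemma word_mean_sum (J : finType) n (F : J -> seq I -> R) :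
  word_mean n (fun s => \sum_j F j s) = \sum_j word_mean n (F j).
Proof.
elim: n F => // n IHn F; rewrite !word_meanS.
under eq_bigr do rewrite IHn mulr_sumr.
by rewrite exchange_big; apply: eq_bigr => j _; rewrite word_meanS.
Qed.

Hypothesis p_ge0 : forall i, 0 <= p i.
Hypothesis p_sum1 : \sum_i p i = 1.

Lemma word_mean_cst n a : word_mean n (fun=> a) = a.
Proof.
elim: n => // n IHn; rewrite word_meanS.
by under eq_bigr do rewrite IHn; rewrite -mulr_suml p_sum1 mul1r.
Qed.

(** Letters of weight 0 are left out of the comparison: a vanishing variance determines the
    logarithms only on the support of [p]. *)
Lemma ler_word_mean_support n F G :
  (forall s, size s = n -> all (fun i => p i != 0) s -> F s <= G s) ->
  word_mean n F <= word_mean n G.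
Proof.
elim: n F G => [|n IHn] F G FG; first exact: FG.
rewrite !word_meanS; apply: ler_sum => i _.
have [->|pi0] := eqVneq (p i) 0; first by rewrite !mul0r.
apply: ler_wpM2l => //; apply: IHn => s sn ps.
by apply: FG; rewrite /= ?sn ?pi0.
Qed.

Lemma ler_word_mean n F G : (forall s, size s = n -> F s <= G s) ->
  word_mean n F <= word_mean n G.
Proof. by move=> FG; apply: ler_word_mean_support => s sn _; exact: FG. Qed.

(** The two indicators differ at most where [B] holds, so an exceptional event costs no more than
    its own probability. *)
Lemma word_mean_agree n (Q1 Q2 B : pred (seq I)) :
  (forall s, size s = n -> all (fun i => p i != 0) s -> ~~ B s ->
    Q1 s = Q2 s) ->
  `|word_mean n (fun s => (Q1 s)%:R) - word_mean n (fun s => (Q2 s)%:R)| <=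
  word_mean n (fun s => (B s)%:R).
Proof.
move=> Q12; rewrite ler_norml -word_meanB lerNl.
have -> : - word_mean n (fun s => (Q1 s)%:R - (Q2 s)%:R) =
    word_mean n (fun s => (Q2 s)%:R - (Q1 s)%:R).
  by rewrite !word_meanB opprB.
apply/andP; split; apply: ler_word_mean_support => s sn ps;
  (case: (boolP (B s)) => [_|/(Q12 s sn ps) ->]; last by rewrite subrr ler0n);
  by case: (Q1 s); case: (Q2 s); rewrite /= ?mulr1n ?mulr0n; lra.
Qed.

Context (x : I -> R).
Let S (s : seq I) := \sum_(i <- s) x i.

(* Integrating out the letters one at a time, each of them contributes the
   same term: no exchangeability of the letters has to be invoked. *)
Lemma word_mean_size_bias n (F : R -> R) :
  word_mean n.+1 (fun s => S s * F (S s)) =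
  n.+1%:R * word_mean n (fun s => \sum_i p i * (x i * F (x i + S s))).
Proof.
elim: n F => [|n IHn] F.
  rewrite mul1r word_meanS word_mean0; apply: eq_bigr => i _.
  by rewrite word_mean0 /S big_cons !big_nil addr0.
have Scons i s : S (i :: s) = x i + S s by rewrite /S big_cons.
rewrite [LHS]word_meanS.
(* The induction hypothesis is applied to the translate of [F] by [x i]. The first letter adds one
   more term of the same shape, which raises the factor [n.+1] to [n.+2]. *)
have step i : word_mean n.+1 (fun s => S (i :: s) * F (S (i :: s))) =
    x i * word_mean n.+1 (fun s => F (x i + S s)) +
    n.+1%:R * word_mean n (fun s => \sum_j p j * (x j * F (x i + (x j + S s)))).
  rewrite -(IHn (fun t => F (x i + t))) -word_meanZ -word_meanD.
  by apply: eq_word_mean => s; rewrite Scons mulrDl.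
under eq_bigr do rewrite step mulrDr.
rewrite big_split /= -(natr1 n.+1) mulrDl mul1r addrC; congr (_ + _).
  rewrite mulr_sumr; apply: eq_bigr => i _; rewrite mulrCA; congr (_ * (_ * _)).
  apply: eq_word_mean => s; apply: eq_bigr => j _.
  by rewrite Scons [x j + (_ + _)]addrCA.
rewrite word_mean_sum.
by apply: eq_bigr => i _; rewrite !word_meanZ.
Qed.

Hypothesis x_mean0 : \sum_i p i * x i = 0.

(** Size biasing with [F = id]; the cross terms vanish because [x] has mean 0. *)
Lemma word_mean_sqr n :
  word_mean n (fun s => S s ^+ 2) = n%:R * \sum_i p i * x i ^+ 2.
Proof.
case: n => [|n]; first by rewrite word_mean0 /S big_nil expr0n mul0r.
under eq_word_mean do rewrite expr2.
rewrite (word_mean_size_bias n id) -[in RHS](word_mean_cst n (\sum_i _)).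
congr (_ * _); apply: eq_word_mean => s.
under eq_bigr do rewrite mulrDr mulrDr.
rewrite big_split /=; under [X in _ + X]eq_bigr do rewrite mulrA.
by rewrite -mulr_suml x_mean0 mul0r addr0; apply: eq_bigr.
Qed.

(** Chebyshev's inequality. *)
Lemma word_mean_norm_ge n (a : R) : 0 < a ->
  word_mean n (fun s => (a <= `|S s|)%R%:R) <=
  n%:R * (\sum_i p i * x i ^+ 2) / a ^+ 2.
Proof.
move=> a0; rewrite -word_mean_sqr mulrC -word_meanZ.
apply: ler_word_mean => s _; case: (leP a `|S s|) => [aS|_]; last first.
  by rewrite mulr0n mulr_ge0 ?invr_ge0 ?sqr_ge0.
rewrite mulr1n ler_pdivlMl ?exprn_gt0// mulr1 -[leRHS]real_normK ?num_real//.
by rewrite lerXn2r ?nnegrE// ltW.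
Qed.

Hypothesis x_var1 : \sum_i p i * x i ^+ 2 = 1.

(** Size biasing turns the mean of [W * f W] into that of the sum of [p i * sqrt n * x i * f (w + x
    i / sqrt n)], with [w] built from the other letters. Expanding at [w], the term in [f w] dies by
    mean 0, the term in [df w] cancels against the mean of [df W] by variance 1, and remainders of
    order [1 / sqrt n] are left. *)
Lemma stein_discrepancy n (f df : R -> R) (B C : R) :
  (forall i, `|x i| <= B) ->
  (forall w y, `|f (w + y) - f w - y * df w| <= C * y ^+ 2) ->
  (forall w y, `|df (w + y) - df w| <= C * `|y|) ->
  (0 < n)%N ->
  let W s := S s / Num.sqrt n%:R in
  word_mean n (fun s => df (W s) - W s * f (W s)) <= C * B *+ 2 / Num.sqrt n%:R.
Proof.
move=> xB fC dfC; case: n => // n _ /=.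
set r := (Num.sqrt _)^-1.
have r0 : 0 < r by rewrite invr_gt0 sqrtr_gt0.
have nrr : n.+1%:R * r * r = 1.
  by rewrite -mulrA -expr2 /r exprVn sqr_sqrtr// divff ?pnatr_eq0.
rewrite word_meanB.
under [X in _ - X]eq_word_mean do rewrite -mulrA.
rewrite (word_mean_size_bias n (fun t => r * f (t * r))) -word_meanZ.
have -> : word_mean n.+1 (fun s => df (S s * r)) =
    word_mean n (fun s => \sum_i p i * df ((x i + S s) * r)).
  rewrite word_mean_sum word_meanS; apply: eq_bigr => i _; rewrite word_meanZ.
  congr (_ * _).
  by apply: eq_word_mean => s; rewrite /S big_cons.
rewrite -word_meanB -(word_mean_cst n (_ * r)).
apply: ler_word_mean => s _; set w := S s * r.
have C0 : 0 <= C.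
  by have := dfC 0 1; rewrite normr1 mulr1; exact: le_trans.
(* Summed over [i], the second and fourth terms on the right cancel by [x_var1], the third vanishes
   by [x_mean0], and the first and last give [C * B * r] each. *)
have term i : p i * df ((x i + S s) * r) -
      n.+1%:R * (p i * (x i * (r * f ((x i + S s) * r)))) <=
    p i * (C * B * r) + p i * (df w) - (p i * x i) * (n.+1%:R * r * f w)
     - (p i * x i ^+ 2) * df w + (p i * x i ^+ 2) * (C * B * r).
  have -> : (x i + S s) * r = w + x i * r by rewrite /w mulrDl addrC.
  have h1 : df (w + x i * r) <= df w + C * B * r.
    rewrite -lerBlDl (le_trans (ler_norm _))// (le_trans (dfC _ _))//.
    rewrite -mulrA; apply: ler_wpM2l => //.
    by rewrite normrM (gtr0_norm r0); apply: ler_wpM2r; [exact: ltW|].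
  have h2 : - (x i * (f (w + x i * r) - f w - (x i * r) * df w)) <=
      C * B * x i ^+ 2 * r ^+ 2.
    rewrite (le_trans (ler_norm _))// normrN normrM.
    apply: (@le_trans _ _ (B * (C * (x i * r) ^+ 2))).
      by apply: ler_pM.
    by rewrite exprMn le_eqVlt; apply/orP; left; apply/eqP; ring.
  have h2' := ler_wpM2l (ltW (mulr_gt0 (ltr0Sn R n) r0)) h2.
  have e : n.+1%:R * r * (C * B * x i ^+ 2 * r ^+ 2) = C * B * x i ^+ 2 * r.
    rewrite (_ : _ * _ = n.+1%:R * r * r * (C * B * x i ^+ 2 * r)); last by ring.
    by rewrite nrr mul1r.
  rewrite e in h2'.
  have e2 : n.+1%:R * r * - (x i * (f (w + x i * r) - f w - x i * r * df w)) =
     - n.+1%:R * (x i * (r * f (w + x i * r))) + x i * (n.+1%:R * r * f w)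
     + x i ^+ 2 * (n.+1%:R * r * r) * df w by ring.
  rewrite nrr mulr1 in e2.
  rewrite e2 in h2'.
  rewrite [leLHS](_ : _ = p i * (df (w + x i * r) -
      n.+1%:R * (x i * (r * f (w + x i * r))))); last by ring.
  rewrite [leRHS](_ : _ = p i * (C * B * r + df w - x i * (n.+1%:R * r * f w)
      - x i ^+ 2 * df w + x i ^+ 2 * (C * B * r))); last by ring.
  apply: ler_wpM2l => //; lra.
rewrite mulr_sumr -sumrB (le_trans (ler_sum _ (fun i _ => term i)))//.
rewrite big_split /= 2!sumrB big_split /= -!mulr_suml p_sum1 x_mean0 x_var1.
by rewrite mul0r !mul1r subr0 addrK mulr2n mulrDl.
Qed.
End word_mean.

(** * The Stein equation *)

Section gaussian.
Context (R : realType).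
Notation mu := (@lebesgue_measure R).
Notation phi := (@normal_pdf R 0 1).

Definition gauss_mean (h : R -> R) : R := (\int[mu]_x (h x * phi x))%R.

Lemma std_normal_pdf_gt0 (x : R) : 0 < phi x.
Proof.
rewrite normal_pdfE ?oner_eq0//.
by rewrite mulr_gt0 ?expR_gt0// normal_peak_gt0 ?oner_eq0.
Qed.

Lemma is_derive_std_normal_pdf (x : R) : is_derive x 1 phi (- (x * phi x)).
Proof.
rewrite normal_pdfE ?oner_eq0// /normal_fun.
set c := normal_peak 1.
have h : is_derive x (1 : R) (fun t : R => - (t - 0) ^+ 2 / (1 ^+ 2 *+ 2)) (- x).
  apply: is_derive_eq; rewrite /= expr1n !scaler0 !subr0 /GRing.scale /=; lra.
have := @is_derive1_comp R expR _ x _ _ (is_derive_expR _) h.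
move=> /(@is_deriveZ _ _ _ _ c) h2.
by apply: is_derive_eq; rewrite /GRing.scale /=; ring.
Qed.

Lemma integrable_gauss (h : R -> R) (M : R) : measurable_fun setT h ->
  (forall x, `|h x| <= M) ->
  mu.-integrable setT (fun x => (h x * phi x)%:E).
Proof.
move=> mh hM.
apply: (@le_integrable _ _ _ mu setT measurableT _ (fun x => (M * phi x)%:E)).
- apply/measurable_EFinP/measurable_funM => //; exact: measurable_normal_pdf.
- move=> x _; rewrite lee_fin !normrM.
  by rewrite ler_wpM2r// (le_trans (hM x))// ler_norm.
- under eq_fun do rewrite EFinM.
  apply: integrableZl => //; exact: integrable_normal_pdf.
Qed.

Lemma lipschitz_continuous (h : R -> R) (L : R) :
  (forall x y, `|h x - h y| <= L * `|x - y|) -> continuous h.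
Proof.
move=> hL x.
have L0 : 0 <= L.
  by have := hL 1 0; rewrite subr0 normr1 mulr1; exact: le_trans.
apply/cvgrPdist_le => e e0; near=> y.
rewrite (le_trans (hL _ _))//.
(* [L + 1] is positive even when [L = 0]. *)
have : `|x - y| <= e / (L + 1).
  near: y; apply: (@cvgr_dist_le _ R^o R (nbhs x) _ id x cvg_id).
  by rewrite divr_gt0// ltr_wpDl.
rewrite ler_pdivlMr ?ltr_wpDl//; apply: le_trans.
by rewrite mulrC ler_wpM2l// lerDl.
Unshelve. all: by end_near. Qed.

Lemma bounded_derive_lipschitz (h dh : R -> R) (C : R) :
  (forall x, is_derive x (1 : R) h (dh x)) -> (forall x, `|dh x| <= C) ->
  forall x y, `|h x - h y| <= C * `|x - y|.
Proof.
move=> hd dhC; suff lt x y : x < y -> `|h y - h x| <= C * `|y - x|.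
  move=> x y; case: (ltgtP x y) => [/lt| /lt//|->].
    by rewrite distrC (distrC y).
  by rewrite !subrr normr0 mulr0.
move=> xy; have [|c _ ->] := @MVT _ h dh x y xy (fun z _ => hd z).
  apply: derivable_within_continuous => z _.
  exact: (@ex_derive _ _ _ _ _ _ _ (hd z)).
by rewrite normrM ler_wpM2r.
Qed.

Lemma compactly_supported_bounded (h : R -> R) (K : R) : continuous h ->
  (forall x, K <= `|x| -> h x = 0) -> exists M, forall x, `|h x| <= M.
Proof.
move=> ch hK.
have [M [_ hM]] : bounded_set (h @` `[- K, K]).
  apply: compact_bounded; apply: continuous_compact.
    exact: continuous_subspaceT.
  exact: segment_compact.
exists (`|M| + 1) => x; have [/hK->|xK] := leP K `|x|.
  by rewrite normr0 addr_ge0.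
apply: (hM (`|M| + 1)); first by rewrite ltr_pwDr// ler_norm.
by exists x => //=; rewrite in_itv/= -ler_norml ltW.
Qed.

(* [f] vanishes outside [-K, K] because [g] has Gaussian mean 0, which makes
   all bounds immediate by compactness. *)
Lemma stein_solution (g : R -> R) (K L : R) :
  (forall x y, `|g x - g y| <= L * `|x - y|) ->
  (forall x, K <= `|x| -> g x = 0) -> gauss_mean g = 0 ->
  exists (f : R -> R) (C : R),
    (forall x, is_derive x (1 : R) f (x * f x + g x)) /\
    (forall x y, `|(x * f x + g x) - (y * f y + g y)| <= C * `|x - y|).
Proof.
move=> gL gK g0.
have cg := lipschitz_continuous gL.
have [M gM] := compactly_supported_bounded cg gK.
have mg := continuous_measurable_fun cg.
(* Variation of constants: since [phi] has derivative [- (x * phi x)], the quotient [G / phi] solves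
   the equation. *)
pose G (x : R) := (\int[mu]_(t in `]-oo, x]) (g t * phi t))%R.
have iG : mu.-integrable setT (EFin \o (fun x => g x * phi x)).
  exact: (integrable_gauss mg gM).
have dG x : is_derive x (1 : R) G (g x * phi x).
  have [||||dG e] := @continuous_FTC1 R (fun x => g x * phi x) -oo%O x (x + 1).
  - by rewrite ltrDl.
  - exact: (integrableS measurableT).
  - by rewrite ltNyr.
  - apply: cvgM; [exact: cg|]; apply: continuous_normal_pdf; exact: oner_neq0.
  - by apply: DeriveDef; [exact: dG|rewrite -derive1E; exact: e].
(* To the left of [- K] the integrand vanishes; to the right of [K] the integral is already the full
   Gaussian mean, which is 0. *)
have GE x : K <= `|x| -> G x = 0.
  move=> Kx; have [x0|x0] := leP 0 x.
    rewrite -[RHS]g0 /G /gauss_mean Rintegral_mkcond.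
    apply: eq_Rintegral => t _; rewrite patchE; case: ifPn => //.
    rewrite notin_setE /= in_itv/= => /negP; rewrite -ltNge => xt.
    rewrite gK ?mul0r// (le_trans Kx)// ger0_norm// (le_trans (ltW xt))//.
    exact: ler_norm.
  transitivity (\int[mu]_(t in `]-oo, x]) (0 : R))%R.
    apply: eq_Rintegral => t; rewrite inE/= in_itv/= => tx.
    rewrite gK ?mul0r// (le_trans Kx)//.
    by rewrite !ltr0_norm ?lerN2// (le_lt_trans tx).
  by rewrite /Rintegral integral0.
pose f x := G x / phi x.
have df x : is_derive x (1 : R) f (x * f x + g x).
  have h1 := is_derive_std_normal_pdf x.
  have n0 : phi x != 0 by rewrite gt_eqF// std_normal_pdf_gt0.
  have h2 := is_deriveV n0 h1.
  have h3 := is_deriveM (dG x) h2.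
  apply: (is_derive_eq h3).
  rewrite /GRing.scale/= /f; field. exact: n0.
have fK x : K <= `|x| -> f x = 0 by move=> /GE fx; rewrite /f fx mul0r.
have cf : continuous f.
  move=> x; apply: differentiable_continuous; apply/derivable1_diffP.
  exact: (@ex_derive _ _ _ _ _ _ _ (df x)).
(* [d2] is the derivative of [x * f x], continuous with compact support, hence bounded. As [g] is
   merely Lipschitz, it is treated separately and contributes [L] to the final constant. *)
pose d2 x := f x + x * (x * f x + g x).
have dxf x : is_derive x (1 : R) (fun x => x * f x) (d2 x).
  have := is_deriveM (is_derive_id x 1) (df x).
  by move=> h; apply: (is_derive_eq h); rewrite /GRing.scale/= /d2; ring.
have cd2 : continuous d2.
  move=> x; apply: cvgD; first exact: cf.
  apply: cvgM; first exact: cvg_id.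
  apply: cvgD; last exact: cg.
  apply: cvgM; [exact: cvg_id|exact: cf].
have d2K x : K <= `|x| -> d2 x = 0.
  by move=> Kx; rewrite /d2 fK// gK// mulr0 addr0 mulr0 addr0.
have [N d2N] := compactly_supported_bounded cd2 d2K.
exists f, (N + L); split => // x y.
rewrite opprD addrACA (le_trans (ler_normD _ _))// mulrDl lerD//.
exact: (bounded_derive_lipschitz dxf d2N).
Qed.
End gaussian.

(** * The central limit theorem *)

Section clamp.
Context (R : realDomainType).
Implicit Types u v : R.

Definition clamp u : R := Num.max 0 (Num.min 1 u).

Lemma clamp_ge0 u : 0 <= clamp u.
Proof. by rewrite le_max lexx. Qed.

Lemma clamp_le1 u : clamp u <= 1.
Proof. by rewrite ge_max ler01 ge_min lexx. Qed.

Lemma clamp_eq1 u : 1 <= u -> clamp u = 1.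
Proof. by move=> u1; rewrite /clamp (min_idPl u1) (max_idPr ler01). Qed.

Lemma clamp_eq0 u : u <= 0 -> clamp u = 0.
Proof. by move=> u0; apply/max_idPl; rewrite ge_min u0 orbT. Qed.

Lemma clamp_lipschitz u v : `|clamp u - clamp v| <= `|u - v|.
Proof.
wlog uv : u v / u <= v.
  move=> h; have [/h//|/ltW/h] := leP u v.
  by rewrite distrC (distrC v).
rewrite !(distrC u) (distrC (clamp u)).
rewrite (ger0_norm (_ : 0 <= v - u)) ?subr_ge0// ler_norml /clamp.
by case: (lerP 1 u) => ?; case: (lerP 1 v) => ?; rewrite ?(max_idPr ler01);
  (try case: (lerP 0 u) => ?); (try case: (lerP 0 v) => ?); apply/andP; split;
  lra.
Qed.

End clamp.

(** * Gaussian means and cut-off functions *)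

Section gaussian_mean.
Context (R : realType).
Notation mu := (@lebesgue_measure R).
Notation phi := (@normal_pdf R 0 1).
Implicit Types h : R -> R.

Lemma gauss_mean_indic (A : set R) : measurable A ->
  gauss_mean \1_A = fine (normal_prob 0 1 A).
Proof.
move=> mA; rewrite /gauss_mean /normal_prob -[RHS]/(\int[mu]_(x in A) _)%R.
rewrite [RHS]Rintegral_mkcond; apply: eq_Rintegral => x _.
by rewrite indicE patchE; case: ifPn; rewrite ?mul1r ?mul0r.
Qed.

Lemma gauss_meanD h1 h2 (M1 M2 : R) :
  measurable_fun setT h1 -> (forall x, `|h1 x| <= M1) ->
  measurable_fun setT h2 -> (forall x, `|h2 x| <= M2) ->
  gauss_mean (fun x => h1 x + h2 x) = gauss_mean h1 + gauss_mean h2.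
Proof.
move=> m1 b1 m2 b2; rewrite /gauss_mean -RintegralD//.
- by apply: eq_Rintegral => x _; rewrite mulrDl.
- exact: (integrable_gauss m1 b1).
- exact: (integrable_gauss m2 b2).
Qed.

Lemma gauss_meanZ h (c M : R) :
  measurable_fun setT h -> (forall x, `|h x| <= M) ->
  gauss_mean (fun x => c * h x) = c * gauss_mean h.
Proof.
move=> m b; rewrite /gauss_mean -RintegralZl//.
- by apply: eq_Rintegral => x _; rewrite mulrA.
- exact: (integrable_gauss m b).
Qed.

Lemma le_gauss_mean h1 h2 (M1 M2 : R) :
  measurable_fun setT h1 -> (forall x, `|h1 x| <= M1) ->
  measurable_fun setT h2 -> (forall x, `|h2 x| <= M2) ->
  (forall x, h1 x <= h2 x) ->
  gauss_mean h1 <= gauss_mean h2.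
Proof.
move=> m1 b1 m2 b2 h12; apply: le_Rintegral => //.
- exact: (integrable_gauss m1 b1).
- exact: (integrable_gauss m2 b2).
- by move=> x _; rewrite ler_wpM2r// ltW// std_normal_pdf_gt0.
Qed.

Lemma norm_indic_le1 (A : set R) x : `|\1_A x : R| <= 1.
Proof. by rewrite indicE; case: (_ \in _); rewrite ?normr0 ?normr1. Qed.

(** A Lipschitz cut-off: 1 for [|t| <= K], 0 for [|t| >= K + 1]. *)
Definition plateau (K t : R) := clamp (K + 1 - `|t|).

Lemma plateau_lipschitz (K : R) t u : `|plateau K t - plateau K u| <= `|t - u|.
Proof.
rewrite (le_trans (clamp_lipschitz _ _))// opprD addrACA subrr add0r opprK.
by rewrite addrC (le_trans (ler_dist_dist _ _))// distrC.
Qed.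

Lemma norm_plateau_le1 (K : R) t : `|plateau K t| <= 1.
Proof. by rewrite ger0_norm ?clamp_ge0// clamp_le1. Qed.

Lemma measurable_plateau (K : R) : measurable_fun setT (plateau K).
Proof.
apply: continuous_measurable_fun; apply: (@lipschitz_continuous _ _ 1) => t u.
by rewrite mul1r plateau_lipschitz.
Qed.

(** Continuity of the Gaussian measure along the intervals [-n, n]. The bound [1 <= K * e] serves to
    make [e * t ^+ 2] at least 1 outside the plateau when truncating. *)
Lemma gauss_mean_plateau (e : R) : 0 < e ->
  exists2 K : R, 1 <= K * e & 0 < K /\ 1 - e <= gauss_mean (plateau K).
Proof.
move=> e0.
pose F (n : nat) : set R := `[- n%:R, n%:R]%classic.
have Fsub : (normal_prob 0 1 \o F) n @[n --> \oo] -->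
    normal_prob 0 1 (\bigcup_n F n).
  apply: (@nondecreasing_cvg_mu _ _ _ (normal_prob 0 1) F).
  - by move=> n; exact: measurable_itv.
  - by apply: bigcup_measurable => n _; exact: measurable_itv.
  - move=> n m nm; apply/subsetPset => x; rewrite /F /= !in_itv/= => /andP[a b].
    have nm' : (n%:R : R) <= m%:R by rewrite ler_nat.
    by rewrite (le_trans b nm') (le_trans _ a)// lerN2.
have FT : \bigcup_n F n = setT.
  apply/seteqP; split => // x _; exists (Num.truncn `|x|).+1 => //; rewrite /F /=.
  by rewrite in_itv/= -ler_norml ltW// truncnS_gt.
move: Fsub; rewrite FT probability_setT => /fine_cvgP[_].
move=> /cvgrPdist_le /(_ e e0) [N _ hN].
pose n := (N + (Num.truncn e^-1).+1)%N.
exists n%:R.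
  rewrite -ler_pdivrMr// mul1r ltW// (lt_le_trans (truncnS_gt _))//.
  by rewrite ler_nat leq_addl.
split; first by rewrite ltr0n /n addnS.
have := hN n (leq_addr _ _); rewrite /= => /ler_normlW; rewrite lerBlDr -lerBlDl.
move/le_trans; apply; rewrite -gauss_mean_indic; last exact: measurable_itv.
apply: le_gauss_mean (norm_indic_le1 _) _ (norm_plateau_le1 _) _.
- by apply: measurable_indic; exact: measurable_itv.
- exact: measurable_plateau.
- move=> x; rewrite indicE; case: (boolP (x \in _)) => [|_]; last exact: clamp_ge0.
  rewrite inE /F /= in_itv/= -ler_norml => xn.
  by rewrite /plateau clamp_eq1//; move: xn; lra.
Qed.
End gaussian_mean.

Lemma fine_probability_setC (R : realType) (disp : measure_display)
    (T : measurableType disp) (P : probability T R) (A : set T) :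
  measurable A -> fine (P (~` A)) = 1 - fine (P A).
Proof. by move=> mA; rewrite probability_setC// fineB ?fin_num_measure. Qed.

(** * Convergence in law of the normalised sum *)

Section word_clt.
Context (R : realType) (I : finType) (p : I -> R).
Hypothesis p_ge0 : forall i, 0 <= p i.
Hypothesis p_sum1 : \sum_i p i = 1.
Context (x : I -> R).
Hypothesis x_mean0 : \sum_i p i * x i = 0.
Hypothesis x_var1 : \sum_i p i * x i ^+ 2 = 1.
Let W n (s : seq I) := (\sum_(i <- s) x i) / Num.sqrt n%:R.

(** The Stein equation rewrites the mean of [g (W n s)] as the Stein discrepancy of its solution.
    Upper bounds suffice throughout: lower ones will come from complementary events. *)
Lemma word_mean_compact_test (g : R -> R) (K L e : R) :
  (forall t u, `|g t - g u| <= L * `|t - u|) ->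
  (forall t, K <= `|t| -> g t = 0) -> gauss_mean g = 0 -> 0 < e ->
  \forall n \near \oo, word_mean p n (fun s => g (W n s)) <= e.
Proof.
move=> gL gK g0 e0; have [f [C [df dfC]]] := stein_solution gL gK g0.
have C0 : 0 <= C.
  by have := dfC 1 0; rewrite subr0 normr1 mulr1; exact: le_trans.
pose B := \sum_i `|x i|.
have B0 : 0 <= B by apply: sumr_ge0.
have xB i : `|x i| <= B.
  by rewrite /B (bigD1 i)//= lerDl sumr_ge0.
have taylor w y : `|f (w + y) - f w - y * (w * f w + g w)| <= C * y ^+ 2.
  (* Subtracting the tangent slope at [w] leaves a function whose derivative is at most
     [C * |t - w|]; the mean value theorem then gives the quadratic remainder. *)
  pose k (t : R) := f t - t * (w * f w + g w).
  have dk t : is_derive t (1 : R) k ((t * f t + g t) - (w * f w + g w)).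
    have h := is_deriveB (df t) (is_deriveM (is_derive_id t 1)
       (is_derive_cst (w * f w + g w) t 1)).
    by apply: (is_derive_eq h); rewrite /GRing.scale/=; ring.
  have [c [cw]] : exists c, `|c - w| <= `|y| /\
      k (w + y) - k w = ((c * f c + g c) - (w * f w + g w)) * y.
    have ck a b : {within `[a, b], continuous k}.
      apply: derivable_within_continuous => z _.
      exact: (@ex_derive _ _ _ _ _ _ _ (dk z)).
    have [y0|y0] := leP 0 y.
      have wy : w <= w + y by rewrite lerDl.
      have [c ci ->] := MVT_segment wy (fun z _ => dk z) (ck _ _).
      move: ci; rewrite in_itv/= => /andP[wc cwy]; exists c; split.
        by rewrite !ger0_norm ?subr_ge0// lerBlDl.
      by rewrite [w + y]addrC addrK.
    have wy : w + y <= w by rewrite gerDl ltW.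
    have [c ci e1] := MVT_segment wy (fun z _ => dk z) (ck _ _).
    move: ci; rewrite in_itv/= => /andP[wc cwy]; exists c; split.
      by rewrite ler0_norm ?subr_le0 // ltr0_norm //; lra.
    by rewrite -opprB e1; ring.
  move=> e1.
  have -> : f (w + y) - f w - y * (w * f w + g w) = k (w + y) - k w.
    by rewrite /k; ring.
  rewrite e1 normrM -real_normK ?num_real// expr2 mulrA ler_wpM2r//.
  by rewrite (le_trans (dfC _ _))// ler_wpM2l.
have dfC' w y : `|(w + y) * f (w + y) + g (w + y) - (w * f w + g w)| <= C * `|y|.
  by rewrite (le_trans (dfC _ _))// [w + y]addrC addrK.
have sd n := @stein_discrepancy R I p p_ge0 p_sum1 x x_mean0 x_var1 n f
  (fun t => t * f t + g t) B C xB taylor dfC'.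
near=> n.
have n0 : (0 < n)%N by near: n; exists 1%N.
have h : word_mean p n (fun s => g (W n s)) <= C * B *+ 2 / Num.sqrt n%:R.
  apply: le_trans (sd n n0); rewrite le_eqVlt; apply/orP; left; apply/eqP.
  by apply: eq_word_mean => s; rewrite /W addrAC subrr add0r.
have D0 : 0 <= C * B *+ 2 / e.
  by apply: divr_ge0; [rewrite mulrn_wge0// mulr_ge0|exact: ltW].
rewrite (le_trans h)// ler_pdivrMr ?sqrtr_gt0 ?ltr0n// [e * _]mulrC -ler_pdivrMr//.
rewrite -ler_sqr ?nnegrE ?sqrtr_ge0// sqr_sqrtr//.
by near: n; exact: nbhs_infty_ger.
Unshelve. all: by end_near. Qed.

(* [h - c] times a plateau function is an admissible test function for a
   suitable constant [c]. *)
Lemma word_mean_test_le (h : R -> R) (L e : R) :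
  (forall t u, `|h t - h u| <= L * `|t - u|) ->
  (forall t, 0 <= h t <= 1) -> 0 < e ->
  \forall n \near \oo, word_mean p n (fun s => h (W n s)) <= gauss_mean h + e.
Proof.
(* Three errors of size [d] will add up to at most [e]; [d <= 1 / 2] ensures that [psi] has positive
   Gaussian mean and that [K >= 1]. *)
move=> hL h01 e0; pose d := Num.min (1 / 2) (e / 3).
have [d0 d2 d3] : [/\ 0 < d, d <= 1 / 2 & d <= e / 3].
  by rewrite /d lt_min !ge_min !lexx orbT !divr_gt0.
have [K Kd [K0 psi1]] := gauss_mean_plateau d0.
pose psi := plateau K.
have psi01 t : 0 <= psi t <= 1 by rewrite clamp_ge0 clamp_le1.
have mpsi := measurable_plateau K.
have mh : measurable_fun setT h.
  by apply: continuous_measurable_fun; exact: lipschitz_continuous hL.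
have hb t : `|h t| <= 1 by have /andP[? ?] := h01 t; rewrite ger0_norm.
have hpb t : `|h t * psi t| <= 1.
  by rewrite normrM mulr_ile1 ?norm_plateau_le1.
have mhp : measurable_fun setT (fun t => h t * psi t).
  exact: measurable_funM.
have ge0 (k : R -> R) : (forall t, 0 <= k t) -> 0 <= gauss_mean k.
  move=> k0; apply: Rintegral_ge0 => t _.
  by rewrite mulr_ge0// ltW// std_normal_pdf_gt0.
have hp0 : 0 <= gauss_mean (fun t => h t * psi t).
  apply: ge0 => t; have [/andP[? _] /andP[? _]] := (h01 t, psi01 t).
  exact: mulr_ge0.
have hp_psi : gauss_mean (fun t => h t * psi t) <= gauss_mean psi.
  apply: (le_gauss_mean mhp hpb mpsi (norm_plateau_le1 _)) => t.
  by rewrite ler_piMl//; [case/andP: (psi01 t)|case/andP: (h01 t)].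
have hp_h : gauss_mean (fun t => h t * psi t) <= gauss_mean h.
  apply: (le_gauss_mean mhp hpb mh hb) => t.
  by rewrite ler_piMr//; [case/andP: (h01 t)|case/andP: (psi01 t)].
have psi0 : 0 < gauss_mean psi.
  by apply: lt_le_trans psi1; rewrite subr_gt0 (le_lt_trans d2)//; lra.
(* The average of [h] weighted by [psi], the only constant for which [(h t - c) * psi t] has
   Gaussian mean 0. *)
pose c := gauss_mean (fun t => h t * psi t) / gauss_mean psi.
have c0 : 0 <= c by rewrite divr_ge0// ltW.
have c1 : c <= 1 by rewrite ler_pdivrMr// mul1r.
have ce : c <= gauss_mean h + d.
  have cN : c * gauss_mean psi <= gauss_mean h by rewrite divfK ?gt_eqF.
  have : c * (1 - gauss_mean psi) <= 1 * d.
    have [n1|n1] := leP (gauss_mean psi) 1.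
      by rewrite ler_pM ?subr_ge0// lerBlDr -lerBlDl.
    by rewrite mul1r (le_trans _ (ltW d0))// mulr_ge0_le0// subr_le0 ltW.
  by lra.
pose g t := (h t - c) * psi t.
have hc t : `|h t - c| <= 1.
  by case/andP: (h01 t) => ? ?; rewrite ler_norml; apply/andP; split; lra.
have gL t u : `|g t - g u| <= (L + 1) * `|t - u|.
  have -> : g t - g u = (h t - h u) * psi t + (h u - c) * (psi t - psi u).
    by rewrite /g; ring.
  rewrite (le_trans (ler_normD _ _))// [leRHS]mulrDl !normrM lerD//.
    by rewrite -[leRHS]mulr1 ler_pM// norm_plateau_le1.
  by rewrite ler_pM// plateau_lipschitz.
have gK t : K + 1 <= `|t| -> g t = 0.
  by move=> Kt; rewrite /g /psi /plateau clamp_eq0 ?mulr0// subr_le0.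
have g0 : gauss_mean g = 0.
  have -> : g = (fun t => h t * psi t + (- c) * psi t).
    by apply/funext => t; rewrite /g; ring.
  rewrite (@gauss_meanD _ _ _ 1 c)//.
  - rewrite (@gauss_meanZ _ _ _ 1)//; last exact: norm_plateau_le1.
    by rewrite mulNr divfK ?subrr// gt_eqF.
  - exact: measurable_funM.
  - move=> t; rewrite normrM normrN (ger0_norm c0) ler_piMr//.
    exact: norm_plateau_le1.
near=> n.
have n0 : (0 < n)%N by near: n; exists 1%N.
(* On the plateau [g] equals [h - c]; beyond it [h - c <= 1 <= d * K ^+ 2 <= d * w ^+ 2], and the
   second moment of [W] is 1. *)
have main : word_mean p n (fun s => h (W n s)) <=
    word_mean p n (fun s => (c + g (W n s)) + d * W n s ^+ 2).
  apply: ler_word_mean => // s _; set w := W n s.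
  have : (h w - c) * (1 - psi w) <= 1 * (d * w ^+ 2).
    have [/andP[p0 p1] /andP[h0 h1]] := (psi01 w, h01 w).
    apply: (@le_trans _ _ (1 * (1 - psi w))).
      by rewrite ler_wpM2r ?subr_ge0//; lra.
    rewrite !mul1r; have [wK|Kw] := leP `|w| K.
      rewrite /psi /plateau clamp_eq1; last by lra.
      by rewrite subrr mulr_ge0 ?sqr_ge0// ltW.
    rewrite (@le_trans _ _ 1)//; first by rewrite lerBlDr lerDl.
    have w2 : K ^+ 2 <= w ^+ 2.
      by rewrite -[leRHS]real_normK ?num_real// lerXn2r ?nnegrE// ltW.
    rewrite (@le_trans _ _ (d * K ^+ 2))//; last by rewrite ler_wpM2l// ltW.
    rewrite (le_trans Kd)// mulrC expr2 ler_wpM2l ?(ltW d0)//.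
    rewrite ler_peMl// ?(ltW K0)//.
    by rewrite (le_trans Kd)// ler_piMr ?(ltW K0)//; lra.
  by rewrite /g; lra.
apply: (le_trans main).
rewrite !word_meanD word_mean_cst// (word_meanZ p n d).
have -> : word_mean p n (fun s => W n s ^+ 2) = 1.
  rewrite -[RHS](@mulVf _ (n%:R : R)) ?pnatr_eq0 -?lt0n//.
  have := @word_mean_sqr R I p p_sum1 x x_mean0 n; rewrite x_var1 mulr1 => h1.
  rewrite -[X in _ = _ * X]h1 -word_meanZ.
  by apply: eq_word_mean => s; rewrite /W exprMn exprVn sqr_sqrtr// mulrC.
have : word_mean p n (fun s => g (W n s)) <= d.
  by near: n; exact: (word_mean_compact_test gL gK g0 d0).
by lra.
Unshelve. all: by end_near. Qed.

(** The density is bounded by its peak; this controls the Gaussian mass under the slope of a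
    ramp. *)
Lemma normal_prob_itv_le (a b : R) : a <= b ->
  fine (normal_prob 0 1 `]-oo, b]) <=
  fine (normal_prob 0 1 `]-oo, a]) + normal_peak 1 * (b - a).
Proof.
move=> ab.
have -> : `]-oo, b]%classic = `]-oo, a] `|` `]a, b] :> set R.
  by rewrite -itv_bndbnd_setU// bnd_simp.
rewrite measureU//; last 1 first.
  apply/seteqP; split => // z [] /=; rewrite !in_itv/= => za /andP[az _].
  by move: az; rewrite ltNge za.
rewrite fineD ?fin_num_measure// lerD2l.
have n0 : (1 : R) != 0 by exact: oner_neq0.
apply: (@le_trans _ _ (\int[lebesgue_measure]_(z in `]a, b]) normal_peak 1)%R).
  apply: le_Rintegral => //.
  - apply: (integrableS measurableT) => //; exact: integrable_normal_pdf.
  - have : (@lebesgue_measure R).-integrable `[a, b]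
        (EFin \o (fun=> normal_peak 1)).
      apply: continuous_compact_integrable; first exact: segment_compact.
      by move=> z; exact: cst_continuous.
    apply: integrableS; [exact: measurable_itv|exact: measurable_itv|].
    by apply: subset_itvr; rewrite bnd_simp.
  - by move=> z _; exact: normal_pdf_ub.
have mab : fine (@lebesgue_measure R `]a, b]%classic) = b - a.
  rewrite lebesgue_measure_itv/= lte_fin; case: ltP => //= ba.
  by apply/esym/eqP; rewrite subr_eq0 eq_le ba ab.
by rewrite Rintegral_cst// -mab.
Qed.

(** Indicators are dominated by Lipschitz ramps wide enough to absorb the motion of the threshold
    [y n], which the passage through the logarithm will require. *)
Lemma word_mean_clt (y : nat -> R) (x0 : R) : y n @[n --> \oo] --> x0 ->
  word_mean p n (fun s => (W n s < y n)%R%:R) @[n --> \oo] -->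
  fine (normal_prob 0 1 `]-oo, x0]).
Proof.
move=> yx0; apply/cvgrPdist_le => e e0.
have pk0 : 0 < @normal_peak R 1 by apply: normal_peak_gt0; exact: oner_neq0.
(* Chosen so that a strip of width [2 * d] has Gaussian mass at most [e / 2]. *)
pose d := e / (normal_peak 1 *+ 4).
have d0 : 0 < d by rewrite divr_gt0// mulrn_wgt0.
have de : normal_peak 1 * (2 * d) = e / 2.
  by rewrite /d -(mulr_natl _ 4); field; rewrite gt_eqF.
(* [h 1] falls from 1 to 0 between [x0 + d] and [x0 + 2 * d]; [h (-1)] is its mirror image about
   [x0]. Once [|x0 - y n| <= d], they dominate the indicators of [t < y n] and of [y n <= t]. *)
pose h (sg : R) t := clamp (sg * (x0 - t) / d + 2).
have hL sg : `|sg| = 1 ->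
    forall t u, `|h sg t - h sg u| <= d^-1 * `|t - u|.
  move=> sg1 t u; rewrite (le_trans (clamp_lipschitz _ _))//.
  rewrite (_ : _ - _ = d^-1 * (sg * (u - t))); last by field; rewrite gt_eqF.
  by rewrite !normrM sg1 mul1r gtr0_norm ?invr_gt0// distrC.
have h01 sg t : 0 <= h sg t <= 1 by rewrite clamp_ge0 clamp_le1.
have e20 : 0 < e / 2 by rewrite divr_gt0.
have hm sg : `|sg| = 1 -> measurable_fun setT (h sg).
  move=> /hL hsg; apply: continuous_measurable_fun.
  exact: lipschitz_continuous hsg.
have hb sg t : `|h sg t| <= 1 by have /andP[? ?] := h01 sg t; rewrite ger0_norm.
have d20 : 0 <= 2 * d by rewrite mulr_ge0// ltW.
have hup : gauss_mean (h 1) <= fine (normal_prob 0 1 `]-oo, x0]) + e / 2.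
  have xd : x0 <= x0 + 2 * d by rewrite lerDl.
  have := normal_prob_itv_le xd; rewrite addrAC subrr add0r de.
  apply: le_trans; rewrite -gauss_mean_indic//.
  have n1 : `|1 : R| = 1 by rewrite normr1.
  apply: (le_gauss_mean (hm _ n1) (hb _) _ (norm_indic_le1 _)) => [|t].
    exact: measurable_indic.
  rewrite indicE; case: (boolP (t \in _)) => [_|].
    by case/andP: (h01 1 t).
  rewrite notin_setE /= in_itv/= => /negP; rewrite -ltNge => xt.
  rewrite /h clamp_eq0// mul1r -lerBrDr sub0r ler_pdivrMr//; lra.
have hlo : gauss_mean (h (-1)) <= 1 - fine (normal_prob 0 1 `]-oo, x0]) + e / 2.
  have xd : x0 - 2 * d <= x0 by rewrite gerBl.
  have := normal_prob_itv_le xd; rewrite subKr de.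
  rewrite -lerBlDr => le1; apply: (@le_trans _ _
    (1 - fine (normal_prob 0 1 `]-oo, x0 - 2 * d]))); last by lra.
  rewrite -fine_probability_setC; last exact: measurable_itv.
  rewrite -gauss_mean_indic; last by apply: measurableC; exact: measurable_itv.
  have n1 : `|-1 : R| = 1 by rewrite normrN1.
  apply: (le_gauss_mean (hm _ n1) (hb _) _ (norm_indic_le1 _)) => [|t].
    by apply: measurable_indic; apply: measurableC; exact: measurable_itv.
  rewrite indicE; case: (boolP (t \in _)) => [_|].
    by case/andP: (h01 (-1) t).
  rewrite notin_setE /= in_itv/= => /contrapT xt.
  rewrite /h clamp_eq0// -lerBrDr sub0r ler_pdivrMr//; lra.
have n1 : `|1 : R| = 1 by rewrite normr1.
have n1' : `|-1 : R| = 1 by rewrite normrN1.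
near=> n.
have yn : `|x0 - y n| <= d.
  by near: n; exact: (cvgrPdist_le _ _).1 yx0 d d0.
have /andP[yn1 yn2] : - d <= x0 - y n <= d by rewrite -ler_norml.
have U : word_mean p n (fun s => (W n s < y n)%R%:R) <=
    gauss_mean (h 1) + e / 2.
  apply: (@le_trans _ _ (word_mean p n (fun s => h 1 (W n s)))).
    apply: ler_word_mean => // s _; case: (ltP (W n s) (y n)) => wy; last first.
      by case/andP: (h01 1 (W n s)).
    by rewrite /h clamp_eq1// mul1r -lerBlDr ler_pdivlMr//; lra.
  by near: n; exact: word_mean_test_le (hL _ n1) (h01 _) e20.
(* The lower bound is an upper bound for the complementary event. *)
have L : word_mean p n (fun s => 1 - (W n s < y n)%R%:R) <=
    gauss_mean (h (-1)) + e / 2.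
  apply: (@le_trans _ _ (word_mean p n (fun s => h (-1) (W n s)))).
    apply: ler_word_mean => // s _; case: (ltP (W n s) (y n)) => wy.
      by rewrite subrr; case/andP: (h01 (-1) (W n s)).
    by rewrite subr0 /h clamp_eq1// -lerBlDr ler_pdivlMr//; lra.
  by near: n; exact: word_mean_test_le (hL _ n1') (h01 _) e20.
rewrite word_meanB word_mean_cst// in L.
by rewrite ler_norml; apply/andP; split; lra.
Unshelve. all: by end_near. Qed.

End word_clt.

(** * Triangular matrices *)

Section triangular.
Context (F : fieldType) (n : nat).
Implicit Types A B : 'M[F]_n.

Lemma mulmx_trig A B : is_trig_mx A -> is_trig_mx B -> is_trig_mx (A *m B).
Proof.
move=> /is_trig_mxP tA /is_trig_mxP tB; apply/is_trig_mxP => i j ij.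
rewrite mxE big1// => k _; have [ik|ki] := ltnP i k.
  by rewrite tA// mul0r.
by rewrite tB ?mulr0// (leq_ltn_trans ki ij).
Qed.

Lemma mulmx_trig_diag A B j : is_trig_mx A -> is_trig_mx B ->
  (A *m B) j j = A j j * B j j.
Proof.
move=> /is_trig_mxP tA /is_trig_mxP tB.
rewrite mxE (bigD1 j)//= big1 ?addr0// => k kj.
have [jk|kj'] := ltnP j k; first by rewrite tA// mul0r.
by rewrite tB ?mulr0// ltn_neqAle kj' andbT.
Qed.

Lemma char_poly_trmx A : char_poly A^T = char_poly A.
Proof.
rewrite /char_poly -det_tr; congr (\det _).
by apply/matrixP => i j; rewrite !mxE eq_sym.
Qed.

(** The characteristic polynomial is invariant under transposition and splits over the diagonal. *)
Lemma eigenvalue_trig A a : is_trig_mx A \/ is_trig_mx A^T ->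
  eigenvalue A a = [exists j, a == A j j].
Proof.
move=> tA; rewrite eigenvalue_root_char.
have -> : char_poly A = \prod_(j < n) ('X - (A j j)%:P).
  case: tA => [/char_poly_trig //|/char_poly_trig]; rewrite char_poly_trmx => ->.
  by apply: eq_bigr => j _; rewrite mxE.
rewrite rootE horner_prod; apply/idP/existsP => [|[j /eqP ->]].
  move/prodf_eq0 => [j _]; rewrite hornerXsubC subr_eq0 => aj.
  by exists j.
by apply/prodf_eq0; exists j => //; rewrite hornerXsubC subrr.
Qed.

End triangular.

(** * Spectral radii of products of triangular matrices *)

Section word_products.
Context (R : realType) (d m : nat) (T : 'I_m -> 'M[R[i]]_d).
Hypothesis T_trig : (forall i, is_trig_mx (T i)^T) \/ (forall i, is_trig_mx (T i)).
Hypothesis T_diag : forall i j, T i j j != 0.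

Lemma spectral_radius_trig (A : 'M[R[i]]_d) (j0 : 'I_d) :
  is_trig_mx A \/ is_trig_mx A^T ->
  (forall j, Normc.normc (A j j) <= Normc.normc (A j0 j0)) ->
  spectral_radius A = Normc.normc (A j0 j0).
Proof.
move=> tA maxj0; rewrite /spectral_radius; set E := [set _ | _ in _].
have Ej0 : E (Normc.normc (A j0 j0)).
  by exists (A j0 j0) => //=; rewrite eigenvalue_trig//; apply/existsP; exists j0.
have ubE : ubound E (Normc.normc (A j0 j0)).
  by move=> _ [a /=] + <-; rewrite eigenvalue_trig// => /existsP[j /eqP ->].
apply/eqP; rewrite eq_le ge_sup//=; last by exists (Normc.normc (A j0 j0)).
by apply: ub_le_sup => //; exists (Normc.normc (A j0 j0)).
Qed.

Lemma word_prod_trig (u : nat -> 'I_m) (n : nat) :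
  (is_trig_mx (word_prod T u n) \/ is_trig_mx (word_prod T u n)^T) /\
  forall j, word_prod T u n j j = \prod_(i <- mkseq u n) T i j j.
Proof.
have prodS k j : \prod_(i <- mkseq u k.+1) T i j j =
    T (u k) j j * \prod_(i <- mkseq u k) T i j j.
  by rewrite /mkseq -addn1 iotaD map_cat big_cat big_seq1 mulrC.
(* In the upper triangular case transposition reverses the factors, which is harmless for the
   diagonal entries as these are products of scalars. *)
case: T_trig => tT.
  suff [tW dW] : is_trig_mx (word_prod T u n)^T /\
    forall j, word_prod T u n j j = \prod_(i <- mkseq u n) T i j j.
    by split=> //; right.
  elim: n => [|n [tW dW]] /=.
    split=> [|j]; first by rewrite trmx1 scalar_mx_is_trig.
    by rewrite mxE eqxx big_nil.
  split=> [|j]; first by rewrite trmx_mul mulmx_trig.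
  have trE (A : 'M[R[i]]_d) : A j j = A^T j j by rewrite mxE.
  by rewrite prodS -dW mulrC trE trmx_mul mulmx_trig_diag// -!trE.
suff [tW dW] : is_trig_mx (word_prod T u n) /\
  forall j, word_prod T u n j j = \prod_(i <- mkseq u n) T i j j.
  by split=> //; left.
elim: n => [|n [tW dW]] /=.
  split=> [|j]; first by rewrite scalar_mx_is_trig.
  by rewrite mxE eqxx big_nil.
by split=> [|j]; [rewrite mulmx_trig|rewrite prodS -dW mulmx_trig_diag].
Qed.

Lemma normc_gt0 (z : R[i]) : z != 0 -> 0 < Normc.normc z.
Proof.
move=> z0; rewrite lt_def; apply/andP; split.
  by apply: contra z0 => /eqP /Normc.eq0_normc ->.
by case: z {z0} => a b; exact: sqrtr_ge0.
Qed.

Lemma normc_word_prod_diag (u : nat -> 'I_m) (n : nat) (j : 'I_d) :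
  Normc.normc (word_prod T u n j j) =
  expR (\sum_(i <- mkseq u n) log_diag T j i).
Proof.
rewrite (word_prod_trig u n).2; elim: (mkseq u n) => [|i s IHs].
  by rewrite !big_nil Normc.normc1 expR0.
by rewrite !big_cons Normc.normcM expRD IHs lnK// posrE normc_gt0.
Qed.

(** The moduli of the eigenvalues are exponentials of sums of logarithms, so the largest sum
    decides. For [n = 0] the exponent [n%:R^-1] is 0 and both sides are 1. *)
Lemma spectral_radius_word_prod (u : nat -> 'I_m) (n : nat) (j0 : 'I_d) :
  (forall j, \sum_(i <- mkseq u n) log_diag T j i <=
             \sum_(i <- mkseq u n) log_diag T j0 i) ->
  spectral_radius (word_prod T u n) `^ n%:R^-1 =
  expR ((\sum_(i <- mkseq u n) log_diag T j0 i) / n%:R).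
Proof.
move=> maxj0; have tW := (word_prod_trig u n).1.
rewrite (spectral_radius_trig (j0 := j0) tW).
  by rewrite normc_word_prod_diag expRM.
by move=> j; rewrite !normc_word_prod_diag ler_expR.
Qed.

Context (p : 'I_m -> R).

Lemma rho_inf_atE j : rho_inf_at T p j = expR (\sum_i p i * log_diag T j i).
Proof.
rewrite expR_sum; apply: eq_bigr => i _.
by rewrite mulrC expRM /log_diag lnK// posrE normc_gt0.
Qed.
End word_products.

(** * The law of the random word *)

Section word_law.
Context d (Omega : measurableType d) (R : realType) (P : probability Omega R).
Context (m : nat) (p : 'I_m.+1 -> R) (idx : nat -> {RV P >-> 'I_m.+1}).
Hypothesis idx_iid : iid_with_weights p idx.

Let word n w := mkseq (fun k => idx k w) n.

(** The bridge from the probability space to finite sums: the letters are revealed one at a time,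
    and independence gives each full word the product of its weights. *)
Lemma probability_word (Q : pred (seq 'I_m.+1)) (n : nat) :
  measurable [set w | Q (word n w)] /\
  P [set w | Q (word n w)] = (word_mean p n (fun s => (Q s)%:R))%:E.
Proof.
have wordS k w : word k.+1 w = rcons (word k w) (idx k w).
  by rewrite /word /mkseq -[k.+1]addn1 iotaD map_cat cats1.
have szw k w : size (word k w) = k by rewrite size_mkseq.
(* Written as an intersection over a finite set of indices, the form in which independence is
   stated. *)
have wordE k s : size s = k -> [set w | word k w = s] =
    \bigcap_(j in [set` [fset x | x in iota 0 k]%fset])
       (idx j @^-1` [set nth ord0 s j]).
  move=> sk; apply/seteqP; split => w /=.
    by move=> <- j /=; rewrite !inE mem_iota /= => jk; rewrite nth_mkseq.
  move=> h; apply: (@eq_from_nth _ ord0); rewrite szw// => j jk.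
  rewrite nth_mkseq//; apply: h => /=; by rewrite !inE mem_iota.
have mpre j i : measurable (idx j @^-1` [set i]).
  by rewrite -[X in measurable X]setTI; exact: measurable_funP.
have Pword k s : size s = k -> measurable [set w | word k w = s] /\
    P [set w | word k w = s] = (\prod_(i <- s) p i)%:E.
  move=> sk; rewrite wordE//; split.
    by apply: fin_bigcap_measurable => // j _; exact: mpre.
  rewrite (idx_iid.1 _ (fun j => [set nth ord0 s j]))//.
  rewrite (eq_bigr (fun j => (p (nth ord0 s j))%:E)); last first.
    by move=> j _; exact: idx_iid.2.
  rewrite (perm_big (iota 0 k)) /=; last first.
    apply: uniq_perm; [exact: fset_uniq|exact: iota_uniq|].
    by move=> j; rewrite !inE.
  by rewrite prodEFin (big_nth ord0) sk /index_iota subn0.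
(* Generalised to a known prefix [s] and [l] letters still to come, so that the induction on [l]
   splits on the next letter. *)
suff pre l k s : size s = k ->
    measurable [set w | word k w = s /\ Q (word (k + l) w)] /\
    P [set w | word k w = s /\ Q (word (k + l) w)] =
    (\prod_(i <- s) p i * word_mean p l (fun t => (Q (s ++ t))%:R))%:E.
  have [+ +] := pre n 0%N [::] erefl; rewrite big_nil mul1r.
  have -> : [set w | word 0 w = [::] /\ Q (word (0 + n) w)] =
            [set w | Q (word n w)].
    by apply/seteqP; split => w //= [].
  by [].
elim: l k s => [|l IHl] k s sk.
  have [mk Pk] := Pword k s sk.
  rewrite addn0 word_mean0 cats0; have [Qs|nQs] := boolP (Q s).
    have -> : [set w | word k w = s /\ Q (word k w)] = [set w | word k w = s].
      by apply/seteqP; split => w /= => [[]//|ws]; rewrite ws.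
    by rewrite mulr1.
  have -> : [set w | word k w = s /\ Q (word k w)] = set0.
    by apply/seteqP; split => w //= [->]; apply/negP.
  by rewrite measure0 mulr0.
pose E i := [set w | word k.+1 w = rcons s i /\ Q (word (k.+1 + l) w)].
have IHE i := IHl k.+1 (rcons s i) (etrans (size_rcons _ _) (congr1 S sk)).
have -> : [set w | word k w = s /\ Q (word (k + l.+1) w)] =
    \bigcup_(i in [set: 'I_m.+1]) E i.
  apply/seteqP; split => w /=.
    move=> [ws Qw]; exists (idx k w) => //.
    by rewrite /E /= wordS ws addSnnS.
  by move=> [i _ [/eqP]]; rewrite wordS eqseq_rcons addSnnS => /andP[/eqP ? _].
have tE : trivIset setT E.
  move=> i j _ _ [w [[+ _] [+ _]]] => -> /eqP.
  by rewrite eqseq_rcons => /andP[_ /eqP].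
split.
  by apply: fin_bigcup_measurable => // i _; exact: (IHE i).1.
have fT : finite_set [set: 'I_m.+1] by exact: finite_finset.
rewrite (measure_fin_bigcup _ fT)//; last by move=> i _; exact: (IHE i).1.
have -> : [set: 'I_m.+1] = [set` xpredT] by apply/seteqP.
rewrite -(@bigfs _ _ _ _ (index_enum 'I_m.+1)) ?index_enum_uniq//; last first.
  by move=> i _; rewrite mem_index_enum.
rewrite (eq_bigr _ (fun i _ => (IHE i).2)) sumEFin word_meanS mulr_sumr; congr _%:E.
apply: eq_bigr => i _; rewrite mulrA -cats1 big_cat big_seq1 /=; congr (_ * _).
by apply: eq_word_mean => t; rewrite -catA.
Qed.
End word_law.

(** * From logarithms to the spectral radius *)

Section delta_method.
Context (R : realType).

Lemma cvg_inv_sqrt : (Num.sqrt (n%:R : R))^-1 @[n --> \oo] --> (0 : R).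
Proof.
apply/cvgrPdist_le => e e0; near=> n.
have n0 : (0 < n)%N by near: n; exists 1%N.
have s0 : 0 < Num.sqrt (n%:R : R) by rewrite sqrtr_gt0 ltr0n.
rewrite sub0r normrN gtr0_norm ?invr_gt0// -(invrK e) lef_pV2 ?posrE ?invr_gt0//.
rewrite -ler_sqr ?nnegrE ?invr_ge0 ?(ltW e0) ?(ltW s0)// sqr_sqrtr//.
by near: n; exact: nbhs_infty_ger.
Unshelve. all: by end_near. Qed.

(** The lower bound is the upper one applied to the inverse of [1 + t]. *)
Lemma ln1D_bounds (t : R) : -1 < t -> t / (1 + t) <= ln (1 + t) <= t.
Proof.
move=> t1; have t0 : 0 < 1 + t by lra.
rewrite le_ln1Dx// andbT.
have -> : t / (1 + t) = - ((1 + t)^-1 - 1) by field; rewrite gt_eqF.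
rewrite lerNl -lnV ?posrE//.
have := @le_ln1Dx R ((1 + t)^-1 - 1); rewrite [1 + (_ - _)]addrC subrK; apply.
by move: t0; rewrite -invr_gt0; lra.
Qed.

Lemma cvg_log_threshold (x s : R) : 0 < s ->
  Num.sqrt n%:R / s * ln (1 + x * s / Num.sqrt n%:R) @[n --> \oo] --> x.
Proof.
move=> s0; pose t (n : nat) := x * s / Num.sqrt n%:R.
have t0 : t n @[n --> \oo] --> (0 : R).
  by rewrite -(mulr0 (x * s)); apply: cvgM; [exact: cvg_cst|exact: cvg_inv_sqrt].
have lo : x / (1 + t n) @[n --> \oo] --> x.
  have {2}-> : x = x / (1 + 0) by rewrite addr0 divr1.
  apply: cvgM; first exact: cvg_cst.
  apply: cvgV; first by rewrite addr0 oner_neq0.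
  by apply: cvgD => //; exact: cvg_cst.
apply: squeeze_cvgr lo (cvg_cst x); near=> n.
have n0 : (0 < n)%N by near: n; exists 1%N.
have r0 : 0 < Num.sqrt (n%:R : R) by rewrite sqrtr_gt0 ltr0n.
have t1 : -1 < t n by near: n; apply: (cvgr_gt _ t0); lra.
have k0 : 0 <= Num.sqrt n%:R / s by rewrite divr_ge0 ?ltW.
have kt : Num.sqrt n%:R / s * t n = x.
  by rewrite /t; field; rewrite !gt_eqF.
have /andP[l u] := ln1D_bounds t1.
have := ler_wpM2l k0 u; rewrite kt => ->; rewrite andbT.
by have := ler_wpM2l k0 l; rewrite mulrA kt.
Unshelve. all: by end_near. Qed.

(** The delta method in exact form: with [r = sqrt n], monotonicity of [expR] moves the nonlinearity
    into the threshold. The bound on [x * s / r] keeps the argument of [ln] positive. *)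
Lemma fluctuation_lt (S mu s r x : R) : 0 < s -> 0 < r ->
  -1 < x * s / r ->
  ((expR (S / r ^+ 2) - expR mu) / (r^-1 * (expR mu * s)) < x) =
  ((S - r ^+ 2 * mu) / s / r < r / s * ln (1 + x * s / r)).
Proof.
move=> s0 r0 t1; have t0 : 0 < 1 + x * s / r by lra.
have e0 := expR_gt0 mu.
rewrite ltr_pdivrMr; last by rewrite !mulr_gt0 ?invr_gt0.
rewrite ltrBlDr.
have -> : x * (r^-1 * (expR mu * s)) + expR mu = expR mu * (1 + x * s / r).
  by field; rewrite gt_eqF.
rewrite -[X in expR mu * X]lnK ?posrE// -expRD ltr_expR.
rewrite -ltrBlDl.
have -> : (S - r ^+ 2 * mu) / s / r = r / s * (S / r ^+ 2 - mu).
  by field; rewrite !gt_eqF.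
by rewrite ltr_pM2l ?divr_gt0.
Qed.
End delta_method.

(** * Domination by one diagonal entry *)

Section dominant_entry.
Context (R : realType) (d : nat) (I : finType) (p : I -> R).
Hypothesis p_ge0 : forall i, 0 <= p i.
Hypothesis p_sum1 : \sum_i p i = 1.
Context (l : 'I_d -> I -> R) (j0 : 'I_d).
Hypothesis j0_max : forall j, j != j0 ->
  \sum_i p i * l j i < \sum_i p i * l j0 i.

Definition dominated (s : seq I) : bool :=
  [forall j, \sum_(i <- s) l j i <= \sum_(i <- s) l j0 i].

(** A union bound over [j] and Chebyshev's inequality: the mean lead of [j0] grows like [n] and the
    variance too, so each [j] overtakes with probability [O(1 / n)]. *)
Lemma cvg_not_dominated :
  word_mean p n (fun s => (~~ dominated s)%:R) @[n --> \oo] --> (0 : R).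
Proof.
pose dl j := \sum_i p i * l j0 i - \sum_i p i * l j i.
(* The difference of the two logarithms, recentred by the gap [dl j] of their means. If [j]
   overtakes [j0], the sum of the [x j i] exceeds [n * dl j]. *)
pose x j i := l j i - l j0 i + dl j.
have x0 j : \sum_i p i * x j i = 0.
  rewrite (eq_bigr (fun i => p i * l j i - p i * l j0 i + p i * dl j)); last first.
    by move=> i _; rewrite /x; ring.
  by rewrite big_split sumrB /= -mulr_suml p_sum1 mul1r /dl; ring.
pose v j := \sum_i p i * x j i ^+ 2 / dl j ^+ 2.
pose Cst := \sum_j v j.
have up n : (0 < n)%N ->
    word_mean p n (fun s => (~~ dominated s)%:R) <= Cst / n%:R.
  move=> n0; apply: (@le_trans _ _ (\sum_j word_mean p n (fun s =>
      (\sum_(i <- s) l j0 i < \sum_(i <- s) l j i)%R%:R))).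
    rewrite -word_mean_sum; apply: ler_word_mean => // s _.
    case: (boolP (dominated s)) => [_|]; first by rewrite sumr_ge0.
    rewrite negb_forall => /existsP[j]; rewrite -ltNge => jj.
    by rewrite (bigD1 j)//= jj lerDl sumr_ge0.
  rewrite /Cst mulr_suml; apply: ler_sum => j _.
  have [->|jj0] := eqVneq j j0.
    under eq_word_mean do rewrite ltxx.
    rewrite word_mean_cst// divr_ge0// sumr_ge0// => i _.
    by rewrite divr_ge0 ?sqr_ge0// mulr_ge0// sqr_ge0.
  have dl0 : 0 < dl j by rewrite subr_gt0 j0_max.
  have nd0 : 0 < n%:R * dl j by rewrite mulr_gt0// ltr0n.
  have n1 : (n%:R : R) != 0 by rewrite pnatr_eq0 -lt0n.
  apply: le_trans (le_trans (word_mean_norm_ge p_ge0 p_sum1 (x0 j) n nd0) _).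
    apply: ler_word_mean => // s sn.
    have xs : \sum_(i <- s) x j i =
        \sum_(i <- s) l j i - \sum_(i <- s) l j0 i + n%:R * dl j.
      rewrite big_split sumrB /=; congr (_ + _).
      by rewrite big_const_seq count_predT sn iter_addr_0 mulr_natl.
    case: ltP => [lt|_]; last exact: ler0n.
    rewrite xs ger0_norm; last by apply: addr_ge0; [rewrite subr_ge0|]; exact: ltW.
    by rewrite lerDr subr_ge0 (ltW lt).
  rewrite /v -mulr_suml le_eqVlt; apply/orP; left; apply/eqP.
  by field; rewrite n1 gt_eqF.
have C0 : Cst / n%:R @[n --> \oo] --> (0 : R).
  rewrite -(mulr0 Cst); apply: cvgM; first exact: cvg_cst.
  rewrite (_ : (fun n => _) = (fun n : nat =>
    (Num.sqrt (n%:R : R))^-1 * (Num.sqrt (n%:R : R))^-1)); last first.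
    by apply/funext => n; rewrite -invfM -expr2 sqr_sqrtr.
  by rewrite -[X in _ --> X](mulr0 0); apply: cvgM; exact: cvg_inv_sqrt.
apply: squeeze_cvgr (cvg_cst 0) C0; near=> n.
have n0 : (0 < n)%N by near: n; exists 1%N.
rewrite up// andbT -[leLHS](word_mean_cst p_sum1 n).
by apply: ler_word_mean.
Unshelve. all: by end_near. Qed.

(** Words that are not dominated have vanishing weight, so the events need only be compared on the
    others. *)
Lemma cvg_word_mean_agree (Q1 Q2 : nat -> pred (seq I)) (a : R) :
  (\forall n \near \oo, forall s, size s = n ->
    all (fun i => p i != 0) s -> dominated s -> Q1 n s = Q2 n s) ->
  word_mean p n (fun s => (Q2 n s)%:R) @[n --> \oo] --> a ->
  word_mean p n (fun s => (Q1 n s)%:R) @[n --> \oo] --> a.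
Proof.
move=> Q12 Q2a; rewrite -(addr0 a).
rewrite (_ : (fun n => _) = (fun n => word_mean p n (fun s => (Q2 n s)%:R) +
   (word_mean p n (fun s => (Q1 n s)%:R) - word_mean p n (fun s => (Q2 n s)%:R))));
  last by apply/funext => n; rewrite addrC subrK.
apply: cvgD => //.
apply/cvgrPdist_le => e e0; near=> n; rewrite sub0r normrN.
apply: le_trans (_ : word_mean p n (fun s => (~~ dominated s)%:R) <= e).
  apply: word_mean_agree => // s sn ps; rewrite negbK => ds.
  by move: s sn ps ds; near: n.
by near: n; apply: (cvgr_le _ cvg_not_dominated).
Unshelve. all: by end_near. Qed.
End dominant_entry.

Theorem corollary1 (R : realType) (disp : measure_display)
    (Omega : measurableType disp) (P : probability Omega R)
    (d m : nat) (T : 'I_m.+1 -> 'M[R[i]]_d) (p : 'I_m.+1 -> R)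
    (idx : nat -> {RV P >-> 'I_m.+1}) (jstar : 'I_d)
    (p_ge0 : forall i, 0 <= p i) (p_sum1 : \sum_(i < m.+1) p i = 1)
    (idx_iid : iid_with_weights p idx)
    (T_trig : (forall i, is_trig_mx (T i)^T) \/ (forall i, is_trig_mx (T i)))
    (T_diag : forall i j, T i j j != 0)
    (argmaxE : argmax_rho_inf T p = [set jstar]) :
  (0 < sigma_inf_at T p jstar ->
     forall x : R,
       P [set w | (random_rho T idx n w - rho_inf T p) /
                  ((Num.sqrt n%:R)^-1 * sigma_inf_at T p jstar) < x]
         @[n --> \oo] --> std_normal_cdf x) /\
  (sigma_inf_at T p jstar = 0 ->
     cvg_in_distribution
       (fun n => Num.sqrt n%:R \o* (random_rho T idx n \- cst (rho_inf T p))
          : {RV P >-> R})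
       (cst 0 : {RV P >-> R})).
Proof.
pose l j i := log_diag T j i.
pose mu := \sum_i p i * l jstar i.
have rho_mu : rho_inf T p = expR mu.
  have : argmax_rho_inf T p jstar by rewrite argmaxE.
  by rewrite /argmax_rho_inf /= => <-; rewrite rho_inf_atE.
(* Equality would put [j] into the argmax, which is the singleton of [jstar]. *)
have l_max j : j != jstar -> \sum_i p i * l j i < mu.
  move=> jj; rewrite -ltr_expR -rho_mu -rho_inf_atE// lt_def.
  rewrite /rho_inf le_bigmax andbT; apply: contra jj => /eqP jE.
  have : argmax_rho_inf T p j by rewrite /argmax_rho_inf /= /rho_inf -jE.
  by rewrite argmaxE => ->.
(* The random radius as a function of a finite word; on a word of length [n] the default letter
   [ord0] is never read. *)
pose rr n s := spectral_radius (word_prod T (nth ord0 s) n) `^ n%:R^-1.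
have rrE n w : random_rho T idx n w = rr n (mkseq (fun k => idx k w) n).
  rewrite /random_rho /rr; set u := fun k => idx k w.
  rewrite (@eq_word_prod _ _ _ T u (nth ord0 (mkseq u n)))// => k kn.
  by rewrite nth_mkseq.
have rr_dom n s : size s = n -> dominated l jstar s ->
    rr n s = expR ((\sum_(i <- s) l jstar i) / n%:R).
  move=> sn /forallP dom; rewrite /rr.
  have sE : mkseq (nth ord0 s) n = s by rewrite -sn mkseq_nth.
  by rewrite (spectral_radius_word_prod T_trig T_diag (j0 := jstar)) sE.
have PE (Q : nat -> pred (seq 'I_m.+1)) (A : nat -> set Omega) (a : R) (b : \bar R) :
    (forall n, A n = [set w | Q n (mkseq (fun k => idx k w) n)]) ->
    b = a%:E ->
    word_mean p n (fun s => (Q n s)%:R) @[n --> \oo] --> a ->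
    P (A n) @[n --> \oo] --> b.
  move=> AE -> h; apply/fine_cvgP; split.
    near=> n; rewrite fin_num_measure// AE.
    exact: (probability_word idx_iid _ _).1.
  apply: cvg_trans h; apply: near_eq_cvg; near=> n.
  by rewrite /= AE (probability_word idx_iid _ _).2.
pose v := \sum_i p i * l jstar i ^+ 2 - mu ^+ 2.
have sigmaE : sigma_inf_at T p jstar = expR mu * Num.sqrt v.
  by rewrite /sigma_inf_at rho_inf_atE.
(* The variance in centred form, used to standardise the letters and, when it is 0, to make them
   constant. *)
have vE : v = \sum_i p i * (l jstar i - mu) ^+ 2.
  rewrite (eq_bigr (fun i => p i * l jstar i ^+ 2 - p i * l jstar i * (mu *+ 2) +
     p i * mu ^+ 2)); last by move=> i _; ring.
  by rewrite big_split sumrB /= -!mulr_suml p_sum1 -/mu /v; ring.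
rewrite sigmaE; split.
  rewrite pmulr_rgt0 ?expR_gt0// => s0 x.
  set s := Num.sqrt v in s0 *.
  pose y i := (l jstar i - mu) / s.
  have y0 : \sum_i p i * y i = 0.
    rewrite (eq_bigr (fun i => (p i * l jstar i - p i * mu) / s)); last first.
      by move=> i _; rewrite /y; ring.
    by rewrite -mulr_suml sumrB -mulr_suml p_sum1 mul1r subrr mul0r.
  have y1 : \sum_i p i * y i ^+ 2 = 1.
    rewrite (eq_bigr (fun i => (p i * (l jstar i - mu) ^+ 2) / s ^+ 2)); last first.
      by move=> i _; rewrite /y; field; rewrite gt_eqF.
    rewrite -mulr_suml -vE -[X in X / _]sqr_sqrtr ?divff//.
      by rewrite expf_neq0// gt_eqF.
    by rewrite ltW// -sqrtr_gt0.
  apply: (PE (fun n w => (rr n w - rho_inf T p) / ((Num.sqrt n%:R)^-1 *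
      (expR mu * s)) < x) _ (fine (std_normal_cdf x))).
  - by move=> n; apply/seteqP; split => w /=; rewrite rrE.
  - by rewrite fineK// fin_num_measure.
  have thr := cvg_log_threshold (x := x) s0.
  have clt := word_mean_clt p_ge0 p_sum1 y0 y1 thr.
  apply: (cvg_word_mean_agree p_ge0 p_sum1 l_max) clt.
  have t0 : x * s / Num.sqrt n%:R @[n --> \oo] --> (0 : R).
    rewrite -(mulr0 (x * s)); apply: cvgM; first exact: cvg_cst.
    exact: cvg_inv_sqrt.
  near=> n => w wn _ dw.
  have n0 : (0 < n)%N by near: n; exists 1%N.
  have r0 : 0 < Num.sqrt (n%:R : R) by rewrite sqrtr_gt0 ltr0n.
  have t1 : -1 < x * s / Num.sqrt n%:R by near: n; apply: (cvgr_gt _ t0); lra.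
  rewrite rr_dom// rho_mu.
  have := fluctuation_lt (\sum_(i <- w) l jstar i) mu s0 r0 t1.
  rewrite sqr_sqrtr// => ->; congr (_ / _ < _).
  rewrite /y -mulr_suml sumrB; congr ((_ - _) / _).
  by rewrite big_const_seq count_predT wn iter_addr_0 mulr_natl.
move=> /eqP; rewrite mulf_eq0 gt_eqF ?expR_gt0//= sqrtr_eq0 => v0.
(* A sum of nonnegative terms equal to 0: the logarithms equal [mu] on the support of [p]. Hence
   [rho_n] is exactly [rho_inf] on dominated words of positive weight, for [n > 0]. *)
have l_mu i : p i != 0 -> l jstar i = mu.
  have t0 k : 0 <= p k * (l jstar k - mu) ^+ 2 by rewrite mulr_ge0// sqr_ge0.
  have /eqP : \sum_k p k * (l jstar k - mu) ^+ 2 = 0.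
    by apply/eqP; rewrite eq_le -vE v0 vE sumr_ge0.
  rewrite psumr_eq0// => /allP/(_ i (mem_index_enum i)).
  by rewrite mulf_eq0 sqrf_eq0 subr_eq0 => /orP[->//|/eqP].
move=> x _.
apply: (PE (fun n w => (rr n w - rho_inf T p) * Num.sqrt n%:R <= x) _
   (0 <= x)%R%:R).
- by move=> n; apply/seteqP; split => w /=; rewrite in_itv/= rrE.
- rewrite /cdf /distribution /pushforward.
  case: (leP 0 x) => x0.
    rewrite (_ : _ @^-1` _ = setT) ?probability_setT//.
    by apply/seteqP; split => // w _ /=; rewrite in_itv.
  rewrite (_ : _ @^-1` _ = set0) ?measure0//.
  by apply/seteqP; split => // w /=; rewrite in_itv/= leNgt x0.
(* On those words the fluctuation is 0, so the event reduces to the constant condition [0 <= x]. *)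
apply: (cvg_word_mean_agree p_ge0 p_sum1 l_max
  (Q2 := fun _ _ => 0 <= x)); last first.
  by under eq_fun do rewrite word_mean_cst//; exact: cvg_cst.
near=> n => w wn pw dw.
have n0 : (n%:R : R) != 0 by rewrite pnatr_eq0 -lt0n; near: n; exists 1%N.
rewrite rr_dom// rho_mu.
have -> : \sum_(i <- w) l jstar i = n%:R * mu.
  rewrite -wn -sum1_size natr_sum mulr_suml !big_seq; apply: eq_bigr => i iw.
  by rewrite mul1r l_mu//; exact: (allP pw).
by rewrite mulrAC divff// mul1r subrr mul0r.
Unshelve. all: by end_near. Qed.
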